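(* The weighted independence number and the weighted clique number of a vertex-weighted Maya-Tupi graph $G$ on $n$ vertices can be computed in $\mathcal{O}(n^8)$-time.
   Context: All graphs are finite and simple. A graph $G$ is Maya-Tupi if its vertex set can be partitioned into two (possibly empty) sets $A$ and $B$ such that $\delta(G[A])\ge |A|-2$ (every vertex of $A$ is non-adjacent to at most one other vertex of $A$) and $\Delta(G[B])\le 1$. Vertex weights are given by a function $w\colon V(G)\to\mathbb{R}^+$; the weighted independence number (resp. weighted clique number) is the maximum total weight of an independent set (resp. a clique) of $G$. No partition of $G$ is given as part of the input. *)

(* Defs.v *)
From HB Require Import structures.
From mathcomp Require Import all_boot all_order all_algebra.
From mathcomp Require Import reals.

Set Implicit Arguments.
Unset Strict Implicit.
Unset Printing Implicit Defensive.

Import Order.TTheory GRing.Theory Num.Theory.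

Record sgraph := SGraph {
  vertex :> finType;
  adj : rel vertex;
  adj_sym : symmetric adj;
  adj_irr : irreflexive adj }.

Section Graphs.
Variable G : sgraph.

(* The degree of v in the induced subgraph G[A], for v in A. *)
Definition deg_in (A : {set G}) (v : G) : nat := #|[set u in A | adj v u]|.

(* Truncated subtraction is harmless: a degree bound #|A| - 2 with #|A| < 2
   holds vacuously. *)
Definition maya_tupi : Prop :=
  exists A B : {set G},
    [/\ A :|: B = setT, [disjoint A & B],
        forall v, v \in A -> #|A| - 2 <= deg_in A v
      & forall v, v \in B -> deg_in B v <= 1].

Definition independent (S : {set G}) : bool :=
  [forall u in S, forall v in S, ~~ adj u v].

Definition clique (S : {set G}) : bool :=
  [forall u in S, forall v in S, (u != v) ==> adj u v].

Variable R : realType.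
Local Open Scope ring_scope.

(* For nonnegative weights, the unit 0 of the iterated maximum is the weight of
   the empty set, which is both independent and a clique. *)
Definition weighted_independence_number (w : G -> R) : R :=
  \big[Num.max/0]_(S : {set G} | independent S) \sum_(v in S) w v.

Definition weighted_clique_number (w : G -> R) : R :=
  \big[Num.max/0]_(S : {set G} | clique S) \sum_(v in S) w v.

End Graphs.

(* The machine is a uniform-cost random access machine programmed with while
   loops. It has a word store, whose values are natural numbers below a word
   bound W (any larger intermediate result is a fault, and a faulting program
   has no execution), and a separate store of real numbers, which can only be
   copied, added, subtracted and compared. Each store consists of registers,
   whose names are fixed in the program text, and of a memory, which is
   addressed by computed words. No real constant other than 0 is available,
   and words cannot be extracted from reals except by comparison. *)
Inductive wexp : Type :=
| WConst of nat
| WReg of nat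
| WMem of wexp
| WAdd of wexp & wexp
| WSub of wexp & wexp
| WMul of wexp & wexp.

Inductive rexp : Type :=
| RZero
| RReg of nat
| RMem of wexp
| RAdd of rexp & rexp
| RSub of rexp & rexp.

Inductive bexp : Type :=
| BWle of wexp & wexp
| BRle of rexp & rexp
| BNot of bexp
| BAnd of bexp & bexp.

Inductive cmd : Type :=
| Skip
| SetWReg of nat & wexp
| SetWMem of wexp & wexp
| SetRReg of nat & rexp
| SetRMem of wexp & rexp
| Seq of cmd & cmd
| If of bexp & cmd & cmd
| While of bexp & cmd.

(* The time to evaluate an expression is its number of nodes. *)
Fixpoint wtime (e : wexp) : nat :=
  match e with
  | WConst _ | WReg _ => 1
  | WMem a => (wtime a).+1
  | WAdd a b | WSub a b | WMul a b => (wtime a + wtime b).+1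
  end.

Fixpoint rtime (e : rexp) : nat :=
  match e with
  | RZero | RReg _ => 1
  | RMem a => (wtime a).+1
  | RAdd a b | RSub a b => (rtime a + rtime b).+1
  end.

Fixpoint btime (e : bexp) : nat :=
  match e with
  | BWle a b => (wtime a + wtime b).+1
  | BRle a b => (rtime a + rtime b).+1
  | BNot a => (btime a).+1
  | BAnd a b => (btime a + btime b).+1
  end.

Section Semantics.
Variable R : realType.

Record state := State {
  wreg : nat -> nat;
  wmem : nat -> nat;
  rreg : nat -> R;
  rmem : nat -> R }.

Definition set_wreg s i x :=
  State [eta wreg s with i |-> x] (wmem s) (rreg s) (rmem s).
Definition set_wmem s i x :=
  State (wreg s) [eta wmem s with i |-> x] (rreg s) (rmem s).
Definition set_rreg s i x :=
  State (wreg s) (wmem s) [eta rreg s with i |-> x] (rmem s).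
Definition set_rmem s i x :=
  State (wreg s) (wmem s) (rreg s) [eta rmem s with i |-> x].

Variable W : nat.

Definition word (x : nat) : option nat := if x < W then Some x else None.

Definition oapp2 (A B C : Type) (f : A -> B -> C) (x : option A) (y : option B)
  : option C := obind (fun a => omap (f a) y) x.

(* The subtraction of words is truncated at 0. *)
Fixpoint weval (s : state) (e : wexp) : option nat :=
  match e with
  | WConst k => word k
  | WReg i => Some (wreg s i)
  | WMem a => omap (wmem s) (weval s a)
  | WAdd a b => obind word (oapp2 addn (weval s a) (weval s b))
  | WSub a b => obind word (oapp2 subn (weval s a) (weval s b))
  | WMul a b => obind word (oapp2 muln (weval s a) (weval s b))
  end.

Fixpoint reval (s : state) (e : rexp) : option R :=
  match e with
  | RZero => Some 0%R
  | RReg i => Some (rreg s i)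
  | RMem a => omap (rmem s) (weval s a)
  | RAdd a b => oapp2 (fun x y => x + y)%R (reval s a) (reval s b)
  | RSub a b => oapp2 (fun x y => x - y)%R (reval s a) (reval s b)
  end.

Fixpoint beval (s : state) (e : bexp) : option bool :=
  match e with
  | BWle a b => oapp2 leq (weval s a) (weval s b)
  | BRle a b => oapp2 (fun x y => x <= y)%R (reval s a) (reval s b)
  | BNot a => omap negb (beval s a)
  | BAnd a b => oapp2 andb (beval s a) (beval s b)
  end.

(* exec c s t s': started in state s, the program c halts in state s' after
   time t. *)
Inductive exec : cmd -> state -> nat -> state -> Prop :=
| exec_skip s : exec Skip s 1 s
| exec_wreg s i e x :
    weval s e = Some x ->
    exec (SetWReg i e) s (wtime e).+1 (set_wreg s i x)
| exec_wmem s a e i x :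
    weval s a = Some i -> weval s e = Some x ->
    exec (SetWMem a e) s (wtime a + wtime e).+1 (set_wmem s i x)
| exec_rreg s i e x :
    reval s e = Some x ->
    exec (SetRReg i e) s (rtime e).+1 (set_rreg s i x)
| exec_rmem s a e i x :
    weval s a = Some i -> reval s e = Some x ->
    exec (SetRMem a e) s (wtime a + rtime e).+1 (set_rmem s i x)
| exec_seq c1 c2 s s1 s2 t1 t2 :
    exec c1 s t1 s1 -> exec c2 s1 t2 s2 ->
    exec (Seq c1 c2) s (t1 + t2) s2
| exec_if b c1 c2 s s' v t :
    beval s b = Some v -> exec (if v then c1 else c2) s t s' ->
    exec (If b c1 c2) s (btime b + t).+1 s'
| exec_while_false b c s :
    beval s b = Some false ->
    exec (While b c) s (btime b).+1 s
| exec_while_true b c s s1 s2 t1 t2 :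
    beval s b = Some true -> exec c s t1 s1 -> exec (While b c) s1 t2 s2 ->
    exec (While b c) s (btime b + t1 + t2).+1 s2.

End Semantics.

Section Problems.
Variable R : realType.

(* The input: word register 0 holds n, word memory holds the row-major n x n
   adjacency matrix from address 0 on, real memory holds the n weights from
   address 0 on; everything else is 0. The vertices are numbered by lab. *)
Definition input_state (G : sgraph) (w : G -> R) (n : nat) (lab : 'I_n -> G)
  : state R :=
  State (fun r => if r == 0 then n else 0)
        (fun a => match insub (a %/ n), insub (a %% n) with
                  | Some i, Some j => adj (lab i) (lab j) : nat
                  | _, _ => 0
                  end)
        (fun=> 0%R)
        (fun a => if insub a is Some i then w (lab i) else 0%R).

(* A single program, on words of k * log2 (n + 2) bits, leaves f G w in real
   register 0 for every graph G of the class with every positive weighting w and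
   every numbering of the vertices, within time O(T(n)) where n is the number of
   vertices. The time bound excludes n = 0 only because T(0) may vanish. *)
Definition computable_in_time (class : sgraph -> Prop)
    (f : forall G : sgraph, (G -> R) -> R) (T : nat -> nat) : Prop :=
  exists (P : cmd) (k C : nat),
  forall (G : sgraph) (w : G -> R) (n : nat) (lab : 'I_n -> G),
    class G -> (forall v, 0 < w v)%R -> bijective lab ->
    exists (t : nat) (s : state R),
      [/\ exec (n.+2 ^ k) P (input_state w lab) t s,
          0 < n -> t <= C * T n
        & rreg s 0 = f G w].

End Problems.

(* Main.v *)
Require Import Defs.
From mathcomp Require Import all_boot all_order all_algebra.
From mathcomp Require Import reals.
From mathcomp Require Import zify.

(** The complement of a Maya-Tupi graph is Maya-Tupi, so only independent sets
    matter. Let (A, B) be a partition with A nonempty, and S a nonempty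
    independent set. Every a in A has at most one non-neighbour y in A, so all
    vertices other than a, y and the neighbours of a are in B. If S meets A,
    take a in S; the at most two vertices of S in A form a set F, and the rest
    of S lies among these vertices. If S misses A, take a of least degree in A:
    either all vertices of B have degree below t = deg a, so that the degree
    determines B, or some b in B has deg a <= deg b, and comparing the degrees
    gives |N(a) :&: B| <= 3, so that S has at most three vertices F in N(a).

    Hence for some guess (x, y, t, f1, f2, f3), with F = {f1, f2, f3}, the set S
    lies in the pool of all vertices v not adjacent to F which are in F, or
    outside {x, y} and not adjacent to x, or of degree below t; and the pool
    induces a subgraph of maximum degree at most 1. In such a pool the vertices
    that beat all their neighbours in the pool, in the lexicographic order of
    weight and label, form an optimal independent set. They form an independent
    set for every guess, so no guess has to be verified, and trying all n^6
    guesses with n^2 operations each takes time O(n^8). *)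

Set Implicit Arguments.
Unset Strict Implicit.
Unset Printing Implicit Defensive.

Import Order.TTheory GRing.Theory Num.Theory.

(** * Complements *)

Section Complement.
Variable G : sgraph.

Definition coadj (u v : G) := (u != v) && ~~ adj u v.

Lemma coadj_sym : symmetric coadj.
Proof. by move=> u v; rewrite /coadj eq_sym adj_sym. Qed.

Lemma coadj_irr : irreflexive coadj.
Proof. by move=> u; rewrite /coadj eqxx. Qed.

Definition cograph := SGraph coadj_sym coadj_irr.

Lemma deg_in_cograph (A : {set G}) v :
  v \in A -> @deg_in cograph A v + deg_in A v = #|A|.-1.
Proof.
move=> vA; rewrite (cardsD1 v A) vA /= -(cardsID [set u | adj v u] (A :\ v)).
rewrite add0n addnC /deg_in; congr (_ + _); apply: eq_card => u; rewrite !inE /=.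
  by case: eqP => [->|]; rewrite ?adj_irr ?andbF.
by rewrite /coadj eq_sym andbC -andbA andbCA.
Qed.

(** Complementation exchanges at most one neighbour with at most one non-neighbour, so the two parts
    swap roles. *)
Lemma cograph_maya_tupi : maya_tupi G -> maya_tupi cograph.
Proof.
case=> A [B [AB dAB hA hB]]; exists B, A; split=> [|||].
- by rewrite setUC.
- by rewrite disjoint_sym.
- move=> v vB; move: (hB v vB) (deg_in_cograph vB); move: (deg_in _ _) (deg_in _ _) #|_|.
  by lia.
- move=> v vA; move: (hA v vA) (deg_in_cograph vA); move: (deg_in _ _) (deg_in _ _) #|_|.
  by lia.
Qed.

Lemma independent_cograph (S : {set G}) : @independent cograph S = clique S.
Proof.
apply: eq_forallb => u; congr (_ ==> _); apply: eq_forallb => v; congr (_ ==> _).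
by rewrite /= /coadj negb_and negbK negbK implybE negbK.
Qed.

Lemma weighted_clique_cograph (R : realType) (w : G -> R) :
  weighted_clique_number w = @weighted_independence_number cograph R w.
Proof. by apply: eq_bigl => S; rewrite -independent_cograph. Qed.

End Complement.

(** * Pools and their selections *)

Section Selection.
Variables (G : sgraph) (R : realType) (w : G -> R) (rk : G -> nat).
Hypothesis rk_inj : injective rk.
Hypothesis w_gt0 : forall v, (0 < w v)%R.

(** Ties in weight go to the larger rank. Only [<=] is used because this is the comparison that the
    machine offers. *)
Definition beats (u v : G) : bool :=
  (w v <= w u)%R && ~~ ((w u <= w v)%R && (rk u <= rk v)).

Lemma beats_asym u v : beats u v -> ~~ beats v u.
Proof. rewrite /beats; case: (ltgtP (w u) (w v)) => //=; case: ltngtP => //. Qed.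

Lemma beats_total u v : u != v -> ~~ beats u v -> beats v u.
Proof.
move=> uv; rewrite /beats; case: (ltgtP (w u) (w v)) => //= _; case: ltngtP => //.
by move/rk_inj=> e; rewrite e eqxx in uv.
Qed.

Definition selection (U : {set G}) : {set G} :=
  [set v in U | [forall u in U, ~~ (adj v u && beats u v)]].

Lemma selection_independent U : independent (selection U).
Proof.
apply/forall_inP => u; rewrite inE => /andP[uU /forall_inP hu].
apply/forall_inP => v; rewrite inE => /andP[vU /forall_inP hv].
apply/negP => a; move: (hu v vU) (hv u uU); rewrite a adj_sym a /= => h.
by rewrite beats_total // eq_sym; apply/eqP => e; rewrite e adj_irr in a.
Qed.

(** Exchange argument: each unselected vertex of [S] is replaced by the neighbour in [U] that beats
    it. This is injective and loses no weight. *)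
Lemma selection_max (U S : {set G}) :
  (forall v, v \in U -> deg_in U v <= 1) -> S \subset U -> independent S ->
  (\sum_(v in S) w v <= \sum_(v in selection U) w v)%R.
Proof.
move=> dU /subsetP SU /forall_inP iS.
have one v a b : v \in U -> a \in U -> b \in U -> adj v a -> adj v b -> a = b.
  move=> vU aU bU va vb; apply/eqP/negP => /negP ab.
  suff: 1 < deg_in U v by rewrite ltnNge dU.
  by apply/card_gt1P; exists a, b; split; rewrite ?inE ?aU ?bU.
(* On [S] the default [v] is never reached: an unselected vertex of [U] is beaten by some neighbour
   in [U]. *)
pose phi v := if v \in selection U then v else
  odflt v [pick u in U | adj v u && beats u v].
have phiP v : v \in S -> (v \in selection U /\ phi v = v) \/
    [/\ v \notin selection U, phi v \in selection U, adj v (phi v),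
        phi v \in U & (w v <= w (phi v))%R].
  move=> vS; rewrite /phi; case: ifPn => vsel; [by left|right].
  have vU := SU _ vS.
  case: pickP => [u /and3P[uU vu buv]|no] /=.
    split=> //; last by case/andP: buv.
    (* The only neighbour of [u] in [U] is [v], which does not beat [u]; so [u] is selected. *)
    rewrite inE uU; apply/forall_inP => x xU; apply/negP => /andP[ux bxu].
    have xv : x = v by apply: (one u) => //; rewrite adj_sym.
    by move: (beats_asym buv); rewrite -{1}xv bxu.
  case/negP: vsel; rewrite inE vU; apply/forall_inP => u uU.
  by move: (no u); rewrite uU /= => ->.
(* A vertex of [S] that is the image of a moved one would be its neighbour in [S]; two moved
   vertices with one image are both neighbours of that image, which has a single neighbour in
   [U]. *)
have phi_inj : {in S &, injective phi}.
  move=> a b aS bS.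
  case: (phiP a aS) => [[sa ->]|[sa sa' aa aU _]];
  case: (phiP b bS) => [[sb ->]|[sb sb' ab bU _]] //.
  - by move=> e; move: (forall_inP (iS b bS) a aS); rewrite e ab.
  - by move=> e; move: (forall_inP (iS a aS) b bS); rewrite -e aa.
  - move=> e; apply: (one (phi a) a b aU (SU _ aS) (SU _ bS)).
      by rewrite adj_sym.
    by rewrite e adj_sym.
apply: (@le_trans _ _ (\sum_(v in S) w (phi v))%R).
  by apply: ler_sum => v /phiP [[_ ->]|[]].
rewrite -(big_imset _ phi_inj) /=.
rewrite [leRHS](big_setID (phi @: S)) /=.
rewrite (setIidPr _); first by rewrite lerDl sumr_ge0 // => v _; exact: ltW.
apply/subsetP => _ /imsetP[v vS ->].
by case: (phiP v vS) => [[vs ->]|[]].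
Qed.

Definition deg (v : G) : nat := deg_in [set: G] v.

(** In the intended guess [x] is a vertex of A and [y] its non-neighbour in A, if any; [t = 0]
    switches the degree clause off. *)
Definition pool (x y : G) (t : nat) (f1 f2 f3 : G) : {set G} :=
  [set v | [&& ~~ adj f1 v, ~~ adj f2 v, ~~ adj f3 v &
    [|| v == f1, v == f2, v == f3, [&& v != x, v != y & ~~ adj x v]
      | deg v < t]]].

(** Repetitions let sets with one or two elements fill the three slots of a guess. *)
Lemma set3_of_card (T : finType) (F : {set T}) :
  0 < #|F| -> #|F| <= 3 -> exists f1 f2 f3, F = [set f1; f2; f3].
Proof.
case: (posnP #|F|) => // /card_gt0P[a aF] _.
rewrite (cardsD1 a) aF ltnS => h.
have [e|/card_gt0P[b bF]] := posnP #|F :\ a|.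
  exists a, a, a; move/eqP: e; rewrite cards_eq0 => /eqP e.
  by rewrite -(setD1K aF) e; apply/setP=> z; rewrite !inE; case: eqP.
move: h; rewrite (cardsD1 b) bF ltnS => h.
have [e|/card_gt0P[c cF]] := posnP #|F :\ a :\ b|.
  exists a, b, b; move/eqP: e; rewrite cards_eq0 => /eqP e.
  by rewrite -(setD1K aF) -(setD1K bF) e; apply/setP=> z; rewrite !inE;
     do 2![case: eqP].
move: h; rewrite (cardsD1 c) cF ltnS leqn0 cards_eq0 => /eqP e.
exists a, b, c; rewrite -(setD1K aF) -(setD1K bF) -(setD1K cF) e.
by apply/setP=> z; rewrite !inE; do 3![case: eqP].
Qed.

(** * Good guesses from a Maya-Tupi partition *)

Section Partition.
Variables A B : {set G}.
Hypothesis AB : A :|: B = setT.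
Hypothesis dAB : [disjoint A & B].
Hypothesis degA : forall v, v \in A -> #|A| - 2 <= deg_in A v.
Hypothesis degB : forall v, v \in B -> deg_in B v <= 1.

Let notB v : v \notin B -> v \in A.
Proof. by move=> h; have := in_setT v; rewrite -AB inE (negPf h) orbF. Qed.

Let notA v : v \in A -> v \in B -> False.
Proof. by move=> a b; move/pred0P/(_ v): dAB; rewrite /= a b. Qed.

Lemma nonneighbour_unique a : a \in A ->
  exists y, y \in A /\ forall v, v \in A -> v != a -> ~~ adj a v -> v = y.
Proof.
move=> aA; have dA := degA aA.
have : #|[set v in A | (v != a) && ~~ adj a v]| <= 1.
  have := @deg_in_cograph G A a aA.
  rewrite /deg_in /= /coadj => h.
  suff -> : [set v in A | (v != a) && ~~ adj a v] =
            [set u in A | (a != u) && ~~ adj a u].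
    by move: dA; rewrite /deg_in; move: h; set p := #|_|; set q := #|_|; lia.
  by apply/setP => v; rewrite !inE eq_sym.
case: (set_0Vmem [set v in A | (v != a) && ~~ adj a v]) => [e _|[y yA] h].
  (* Here [a] is adjacent to the rest of A, and [a] itself serves as a default for [y]. *)
  exists a; split=> // v vA va nav.
  by have := in_set0 v; rewrite -e !inE vA va nav.
exists y; split; first by move: yA; rewrite inE => /andP[].
move=> v vA va nav; apply: (card_le1_eqP h) => //.
by rewrite inE vA va nav.
Qed.

(** [deg a] is at least |A| - 2 plus the number of neighbours of [a] in B, while [deg b] is at most
    |A| + 1. *)
Lemma card_neighbours_B a b : a \in A -> b \in B -> deg a <= deg b ->
  #|[set u in B | adj a u]| <= 3.
Proof.
have split_deg v : deg v = deg_in A v + deg_in B v.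
  rewrite /deg /deg_in -cardsUI; set I := _ :&: _.
  have -> : I = set0.
    apply/setP => u; rewrite !inE.
    by apply/negP => /andP[/andP[a1 _] /andP[/(notA a1)]].
  rewrite cards0 addn0; apply: eq_card => u; rewrite !inE.
  by rewrite -andb_orl -in_setU AB inE.
move=> aA bB; rewrite !split_deg -/(deg_in B a).
have := degA aA; have := degB bB.
have : deg_in A b <= #|A|.
  by apply: subset_leq_card; apply/subsetP => u; rewrite inE => /andP[].
have : 0 < #|A| by apply/card_gt0P; exists a.
lia.
Qed.

(** The pool omits all neighbours of F, so its vertices in F are isolated in it; its other vertices
    lie in B and inherit the degree bound of B. Hence [selection_max] applies. *)
Lemma pool_optimal (S F : {set G}) (a : G) (t : nat) :
  independent S -> a \in A -> F \subset S -> 0 < #|F| <= 3 ->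
  (forall v, deg v < t -> v \in B) ->
  (forall s, s \in S -> s \notin F -> s \in B /\ (~~ adj a s \/ deg s < t)) ->
  exists x y f1 f2 f3,
    (\sum_(v in S) w v <=
     \sum_(v in selection (pool x y t f1 f2 f3)) w v)%R.
Proof.
move=> iS aA /subsetP FS /andP[F0 F3] tB SF.
have [y [yA ya]] := nonneighbour_unique aA.
have [f1 [f2 [f3 eF]]] := set3_of_card F0 F3.
exists a, y, f1, f2, f3.
have inF v : (v \in F) = [|| v == f1, v == f2 | v == f3].
  by rewrite eF !inE orbA.
set U := pool _ _ _ _ _ _.
have UF v f : f \in F -> v \in U -> ~~ adj f v.
  by rewrite inF inE => /or3P[] /eqP -> /and4P[].
have UB v : v \in U -> v \notin F -> v \in B.
  rewrite inF !inE => /and4P[_ _ _ h] /norP[n1 /norP[n2 n3]].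
  move: h; rewrite (negPf n1) (negPf n2) (negPf n3) /=.
  case/orP => [/and3P[va vy nav]|/tB //].
  by apply/negPn/negP => /notB vA; case/negP: vy; rewrite (ya v).
apply: selection_max => //.
- move=> v vU; have [vF|vF] := boolP (v \in F).
    rewrite /deg_in (_ : [set _ in _ | _] = set0) ?cards0 //.
    apply/setP => u; rewrite in_set in_set0.
    by apply/negP => /andP[uU]; apply/negP; exact: UF.
  apply: leq_trans (degB (UB _ vU vF)); apply: subset_leq_card.
  apply/subsetP => u; rewrite in_set => /andP[uU vu]; rewrite in_set vu andbT.
  apply: UB => //.
  by apply/negP => uF; move: (UF v u uF vU); rewrite adj_sym vu.
- apply/subsetP => s sS.
  have nad f : f \in F -> ~~ adj f s.
    by move=> /FS fS; exact: (forall_inP (forall_inP iS f fS)).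
  rewrite inE (nad f1) ?(nad f2) ?(nad f3) ?inF ?eqxx ?orbT //=.
  have [|sF] := boolP (s \in F); first by rewrite inF => /or3P[] ->; rewrite ?orbT.
  have [sB [nas|->]] := SF s sS sF; last by rewrite !orbT.
  have sa : s != a by apply/eqP => e; apply: (notA aA); rewrite -e.
  have sy : s != y by apply/eqP => e; apply: (notA yA); rewrite -e.
  by rewrite nas sa sy !orbT.
Qed.

Lemma pool_complete_partition (S : {set G}) :
  A != set0 -> S != set0 -> independent S ->
  exists x y t f1 f2 f3, t < #|G| /\
    (\sum_(v in S) w v <=
     \sum_(v in selection (pool x y t f1 f2 f3)) w v)%R.
Proof.
move=> /set0Pn[a0 a0A] /set0Pn[s0 s0S] iS.
have iSP u v : u \in S -> v \in S -> ~~ adj u v.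
  by move=> uS vS; exact: (forall_inP (forall_inP iS u uS)).
have G0 : 0 < #|G| by apply/card_gt0P; exists a0.
suff [a [t [F [[tn aA] FS F03 tB SF]]]] : exists (a : G) (t : nat) (F : {set G}),
    [/\ t < #|G| /\ a \in A,
    F \subset S, 0 < #|F| <= 3, forall v, deg v < t -> v \in B &
    forall s, s \in S -> s \notin F -> s \in B /\ (~~ adj a s \/ deg s < t)].
  have [x [y [f1 [f2 [f3 h]]]]] := pool_optimal iS aA FS F03 tB SF.
  by exists x, y, t, f1, f2, f3.
have [e|[a]] := set_0Vmem (S :&: A); last first.
  (* A second vertex of [S] in A is non-adjacent to [a], hence equals [y]; so F has at most two
     elements. *)
  rewrite inE => /andP[aS aA]; exists a, 0, (S :&: A); split=> //.
  - by rewrite subsetIl.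
  - apply/andP; split; first by apply/card_gt0P; exists a; rewrite inE aS.
    have [y [yA ya]] := nonneighbour_unique aA.
    apply: (@leq_trans #|[set a; y]|); last by rewrite cards2; case: eqP.
    apply: subset_leq_card; apply/subsetP => v; rewrite !inE => /andP[vS vA].
    by have [//|va] := eqVneq v a; rewrite (ya v) ?eqxx ?orbT ?iSP.
  - move=> s sS; rewrite inE sS /= => sA; split; last by left; rewrite iSP.
    by apply/negPn/negP => /notB; apply/negP.
have SB s : s \in S -> s \in B.
  move=> sS; apply/negPn/negP => /notB sA.
  by have := in_set0 s; rewrite -e inE sS sA.
(* By minimality, a degree below [deg a] certifies membership in B. *)
case: (arg_minnP deg a0A) => a aA amin.
have [/forall_inP h|] := boolP [forall b in B, deg b < deg a].
  exists a, (deg a), [set s0]; split=> //.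
  - split=> //; rewrite -cardsT; apply: proper_card; apply/properP.
    by split; [exact: subsetT|exists a; rewrite ?inE ?adj_irr].
  - by rewrite sub1set.
  - by rewrite cards1.
  - by move=> v; apply: contraLR => /notB vA; rewrite -leqNgt amin.
  - by move=> s sS _; split; [exact: SB|right; apply: h; exact: SB].
case/forall_inPn => b bB; rewrite -leqNgt => ab.
have c3 := card_neighbours_B aA bB ab.
(* F has to be nonempty; if [S] contains no neighbour of [a], any vertex of [S] will do. *)
have [e0|] := eqVneq (S :&: [set u in B | adj a u]) set0.
  exists a, 0, [set s0]; split; rewrite ?sub1set ?cards1 //.
  move=> s sS _; split; first exact: SB.
  left; apply/negP => as_.
  by have := in_set0 s; rewrite -e0 !inE sS as_ SB.
move=> ne; exists a, 0, (S :&: [set u in B | adj a u]); split=> //.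
- by rewrite subsetIl.
- rewrite card_gt0 ne; apply: leq_trans c3; apply: subset_leq_card.
  exact: subsetIr.
- by move=> s sS; rewrite !inE sS SB //= => nas; split; last by left.
Qed.

End Partition.

Lemma pool_complete (S : {set G}) :
  maya_tupi G -> S != set0 -> independent S ->
  exists x y t f1 f2 f3, t < #|G| /\
    (\sum_(v in S) w v <=
     \sum_(v in selection (pool x y t f1 f2 f3)) w v)%R.
Proof.
case=> A [B [AB dAB hA hB]] S0 iS.
have [A0|] := eqVneq A set0; last by move=> A0; apply: (pool_complete_partition AB).
have eB : B = setT by rewrite -AB A0 set0U.
case/set0Pn: (S0) => s sS.
(* With A empty, the whole graph has maximum degree at most 1, so a vertex [s] of [S] can be moved
   into A. *)
apply: (@pool_complete_partition [set s] [set~ s]) => //.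
- by rewrite setUCr.
- by rewrite -setI_eq0 setICr.
- by move=> v _; rewrite cards1.
- move=> v _; apply: leq_trans (hB v _); last by rewrite eB inE.
  apply: subset_leq_card; apply/subsetP => u; rewrite !inE eB.
  by rewrite inE => /andP[_ ->].
- by apply/set0Pn; exists s; rewrite inE.
Qed.

Lemma weighted_independence_numberP (x : R) :
  (exists2 S : {set G}, independent S & x = \sum_(v in S) w v)%R ->
  (forall S : {set G}, independent S -> \sum_(v in S) w v <= x)%R ->
  x = weighted_independence_number w.
Proof.
move=> [S iS ->] h; apply/le_anti/andP; split.
  exact: (le_bigmax_cond _ (fun S : {set G} => \sum_(v in S) w v)%R iS).
apply: bigmax_le => [|T /h //].
by apply: sumr_ge0 => v _; exact: ltW.
Qed.

End Selection.

(** * Running time of nested loops *)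

Fixpoint depth (c : cmd) : nat :=
  match c with
  | Seq c1 c2 | If _ c1 c2 => maxn (depth c1) (depth c2)
  | While _ c => (depth c).+1
  | _ => 0
  end.

(** A coefficient of a power of n rather than a time: n iterations make n + 1 tests, at most 2n,
    hence the doubled guard. The two branches of [If] are added to bound either one. *)
Fixpoint cost (c : cmd) : nat :=
  match c with
  | Skip => 1
  | SetWReg _ e => (wtime e).+1
  | SetWMem a e => (wtime a + wtime e).+1
  | SetRReg _ e => (rtime e).+1
  | SetRMem a e => (wtime a + rtime e).+1
  | Seq c1 c2 => cost c1 + cost c2
  | If b c1 c2 => (btime b).+1 + (cost c1 + cost c2)
  | While b c => (btime b).+1.*2 + cost c
  end.

Definition For (r : nat) (c : cmd) : cmd :=
  Seq (SetWReg r (WConst 0))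
      (While (BNot (BWle (WReg 0) (WReg r)))
             (Seq c (SetWReg r (WAdd (WReg r) (WConst 1))))).

Section Run.
Variables (R : realType) (W n : nat).
(** Leaves room for the addresses of the matrix and of the n degrees stored behind it, and for the
    constant 1 even if n = 0. *)
Hypothesis nW : n * n + n.+1 < W.

Let wordE x : x <= n * n + n.+1 -> word W x = Some x.
Proof. by move=> h; rewrite /word (leq_ltn_trans h nW). Qed.

(* [cost c * n ^ depth c] bounds the time of [c] if each of its loops makes at
   most n iterations, with room for the final test when 0 < n. *)
Definition run (c : cmd) (s : state R) (Q : state R -> Prop) : Prop :=
  exists t s', [/\ exec W c s t s', 0 < n -> t <= cost c * n ^ depth c & Q s'].

Lemma run_impl c s (Q Q' : state R -> Prop) :
  (forall s', Q s' -> Q' s') -> run c s Q -> run c s Q'.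
Proof. by move=> h [t [s' [e ht /h q]]]; exists t, s'. Qed.

Lemma run_skip s (Q : state R -> Prop) : Q s -> run Skip s Q.
Proof. by move=> q; exists 1, s; split=> //; exact: exec_skip. Qed.

Lemma run_wreg (i : nat) e s x (Q : state R -> Prop) :
  weval W s e = Some x -> Q (set_wreg s i x) -> run (SetWReg i e) s Q.
Proof.
move=> h q; exists (wtime e).+1, (set_wreg s i x); split=> //.
  exact: exec_wreg.
by rewrite muln1.
Qed.

Lemma run_wmem a e s i x (Q : state R -> Prop) :
  weval W s a = Some i -> weval W s e = Some x -> Q (set_wmem s i x) ->
  run (SetWMem a e) s Q.
Proof.
move=> h h' q; exists (wtime a + wtime e).+1, (set_wmem s i x); split=> //.
  exact: exec_wmem.
by rewrite muln1.
Qed.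

Lemma run_rreg (i : nat) e s x (Q : state R -> Prop) :
  reval W s e = Some x -> Q (set_rreg s i x) -> run (SetRReg i e) s Q.
Proof.
move=> h q; exists (rtime e).+1, (set_rreg s i x); split=> //.
  exact: exec_rreg.
by rewrite muln1.
Qed.

Lemma run_seq c1 c2 s (Q1 Q : state R -> Prop) :
  run c1 s Q1 -> (forall s', Q1 s' -> run c2 s' Q) -> run (Seq c1 c2) s Q.
Proof.
move=> [t1 [s1 [e1 h1 q1]]] h; have [t2 [s2 [e2 h2 q2]]] := h _ q1.
exists (t1 + t2), s2; split=> //; first exact: exec_seq e1 e2.
move=> n0; rewrite /= mulnDl; apply: leq_add.
  by apply: leq_trans (h1 n0) _; rewrite leq_mul2l leq_pexp2l ?leq_maxl ?orbT.
by apply: leq_trans (h2 n0) _; rewrite leq_mul2l leq_pexp2l ?leq_maxr ?orbT.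
Qed.

Lemma run_if b c1 c2 s v (Q : state R -> Prop) :
  beval W s b = Some v -> run (if v then c1 else c2) s Q ->
  run (If b c1 c2) s Q.
Proof.
move=> hb [t [s' [e h q]]]; exists (btime b + t).+1, s'; split=> //.
  exact: exec_if e.
move=> n0; rewrite -addSn [cost _]/= mulnDl; apply: leq_add.
  by rewrite leq_pmulr // expn_gt0 n0.
apply: leq_trans (h n0) _.
case: (v); apply: leq_mul; rewrite ?leq_addr ?leq_addl //=;
  by rewrite leq_pexp2l ?leq_maxl ?leq_maxr.
Qed.

(** The body must preserve the bound in register 0 and the counter [r], which limits the loop to n
    iterations; [I] is required after the increment. *)
Lemma run_for (r : nat) c s (I : nat -> state R -> Prop) :
  r != 0 -> wreg s 0 = n -> I 0 (set_wreg s r 0) ->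
  (forall i s, i < n -> wreg s 0 = n -> wreg s r = i -> I i s ->
     run c s (fun s' => [/\ wreg s' 0 = n, wreg s' r = i
                          & I i.+1 (set_wreg s' r i.+1)])) ->
  run (For r c) s (fun s' => wreg s' 0 = n /\ I n s').
Proof.
move=> r0 s0 I0 step.
pose b := BNot (BWle (WReg 0) (WReg r)).
pose c' := Seq c (SetWReg r (WAdd (WReg r) (WConst 1))).
(* [m] counts the iterations left. A test takes time 5 and an increment 4: together 9 per iteration,
   and 5 for the last test. *)
have loop m : forall i s, i + m = n -> wreg s 0 = n -> wreg s r = i -> I i s ->
  exists t s', [/\ exec W (While b c') s t s',
    0 < n -> t <= m * (cost c * n ^ depth c + 9) + 5 & wreg s' 0 = n /\ I n s'].
  elim: m => [|m IH] i {s0 I0}s im s0 sr Is.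
    have ei : i = n by rewrite -im addn0.
    exists 5, s; rewrite -[in I n]ei; split=> //.
    by apply: exec_while_false; rewrite /= s0 sr ei leqnn.
  have ltin : i < n by rewrite -im addnS ltnS leq_addr.
  have [t1 [s1 [e1 h1 [q0 qr qI]]]] := step i s ltin s0 sr Is.
  have n0' : (0 == r) = false by rewrite eq_sym; exact: negbTE.
  have [||||t2 [s2 [e2 h2 q2]]] := IH i.+1 (set_wreg s1 r i.+1).
  - by rewrite addSnnS.
  - by rewrite /= n0'.
  - by rewrite /= eqxx.
  - exact: qI.
  exists (4 + (t1 + 4) + t2).+1, s2; split=> //.
    apply: (@exec_while_true _ _ b c' s (set_wreg s1 r i.+1)) e2.
      by rewrite /= s0 sr leqNgt ltin.
    apply: exec_seq e1 _.
    apply: (@exec_wreg R W s1 r (WAdd (WReg r) (WConst 1)) i.+1).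
    by rewrite /= qr !wordE /= ?addn1 ?wordE //; lia.
  by move=> n0; move: (h1 n0) (h2 n0); rewrite mulSn; lia.
have [|||t [s' [e h q]]] := loop n 0 (set_wreg s r 0) (add0n n).
- by rewrite /= eq_sym (negbTE r0).
- by rewrite /= eqxx.
- exact: I0.
exists (2 + t), s'; split=> //.
  apply: exec_seq _ e; apply: (@exec_wreg R W s r (WConst 0) 0).
  by rewrite /= wordE.
(* The overhead 9n + 5 + 2 is at most 16n, and 16 is what [For] adds to [cost c]. *)
move=> n0; move: (h n0); rewrite /= max0n maxn0 expnS.
have : 0 < n ^ depth c by rewrite expn_gt0 n0.
by move: (n ^ _) (cost c) => p C; nia.
Qed.

End Run.

(** * The program *)

Section Program.
Variable co : bool.

Definition EqReg (a b : nat) : bexp :=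
  BAnd (BWle (WReg a) (WReg b)) (BWle (WReg b) (WReg a)).

Definition BOr (a b : bexp) : bexp := BNot (BAnd (BNot a) (BNot b)).

Definition Entry (a b : nat) : bexp :=
  BWle (WConst 1) (WMem (WAdd (WMul (WReg a) (WReg 0)) (WReg b))).

(** The complement is never stored: each query negates a matrix entry and excludes the diagonal. *)
Definition Adj (a b : nat) : bexp :=
  if co then BAnd (BNot (EqReg a b)) (BNot (Entry a b)) else Entry a b.

(** The degree table starts right behind the matrix. *)
Definition DegAddr (a : nat) : wexp := WAdd (WMul (WReg 0) (WReg 0)) (WReg a).

Definition Degrees : cmd :=
  For 7 (Seq (SetWMem (DegAddr 7) (WConst 0))
    (For 8 (If (Adj 7 8)
      (SetWMem (DegAddr 7) (WAdd (WMem (DegAddr 7)) (WConst 1)))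
      Skip))).

(* Word registers 1 to 6 hold the guess x, y, t, f1, f2, f3. *)
Definition Pool (v : nat) : bexp :=
  BAnd (BNot (Adj 4 v)) (BAnd (BNot (Adj 5 v)) (BAnd (BNot (Adj 6 v))
    (BOr (EqReg v 4) (BOr (EqReg v 5) (BOr (EqReg v 6) (BOr
      (BAnd (BNot (EqReg v 1)) (BAnd (BNot (EqReg v 2)) (BNot (Adj 1 v))))
      (BNot (BWle (WReg 3) (WMem (DegAddr v)))))))))).

Definition Beats (u v : nat) : bexp :=
  BAnd (BRle (RMem (WReg v)) (RMem (WReg u)))
    (BNot (BAnd (BRle (RMem (WReg u)) (RMem (WReg v)))
                (BWle (WReg u) (WReg v)))).

(** Register 7 holds the candidate, 8 scans its rivals, 9 stays 1 until a neighbour in the pool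
    beats it; real register 1 accumulates the weight. *)
Definition AddIfSelected : cmd :=
  If (Pool 7)
    (Seq (SetWReg 9 (WConst 1))
      (Seq (For 8 (If (BAnd (Pool 8) (BAnd (Adj 7 8) (Beats 8 7)))
                      (SetWReg 9 (WConst 0)) Skip))
        (If (BWle (WConst 1) (WReg 9))
          (SetRReg 1 (RAdd (RReg 1) (RMem (WReg 7)))) Skip)))
    Skip.

Definition TryGuess : cmd :=
  Seq (SetRReg 1 RZero)
    (Seq (For 7 AddIfSelected)
      (If (BRle (RReg 1) (RReg 0)) Skip (SetRReg 0 (RReg 1)))).

Fixpoint Nest (r k : nat) (c : cmd) : cmd :=
  if k is k'.+1 then For r (Nest r.+1 k' c) else c.

(** Six loops for the guess and two inside [TryGuess] give depth 8, the exponent of the time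
    bound. *)
Definition MaxIndependent : cmd := Seq Degrees (Nest 1 6 TryGuess).

End Program.

(** * Correctness of the program *)

Section Correctness.
Variables (R : realType) (W n : nat) (co : bool) (m0 : nat -> nat) (wt : nat -> R).
Hypothesis nW : n * n + n.+1 < W.

Let wordE x : x <= n * n + n.+1 -> word W x = Some x.
Proof. by move=> h; rewrite /word (leq_ltn_trans h nW). Qed.

(** This and the next definitions restate the graph notions on vertex numbers, so that execution is
    analysed without a graph; [g i] stands for word register i. *)
Definition entry (i j : nat) : bool := 0 < m0 (i * n + j).

Definition nadj (i j : nat) : bool :=
  if co then (i != j) && ~~ entry i j else entry i j.

Definition ndeg (i : nat) : nat := \sum_(0 <= j < n) nadj i j.

Definition nbeats (u v : nat) : bool :=
  (wt v <= wt u)%R && ~~ ((wt u <= wt v)%R && (u <= v)).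

Definition npool (g : nat -> nat) (v : nat) : bool :=
  [&& ~~ nadj (g 4) v, ~~ nadj (g 5) v, ~~ nadj (g 6) v &
    [|| v == g 4, v == g 5, v == g 6,
        [&& v != g 1, v != g 2 & ~~ nadj (g 1) v] | ndeg v < g 3]].

Definition nselected (g : nat -> nat) (v : nat) : bool :=
  npool g v &&
  all (fun u => ~~ [&& npool g u, nadj v u & nbeats u v]) (iota 0 n).

Definition guess_value (g : nat -> nat) : R :=
  (\sum_(0 <= v < n) if nselected g v then wt v else 0)%R.

Lemma npool_ext g g' v : (forall i, 0 < i < 7 -> g i = g' i) -> npool g v = npool g' v.
Proof. by move=> h; rewrite /npool !h. Qed.

Lemma nselected_ext g g' v :
  (forall i, 0 < i < 7 -> g i = g' i) -> nselected g v = nselected g' v.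
Proof.
move=> h; rewrite /nselected (npool_ext _ h); congr (_ && _).
by apply: eq_all => u; rewrite (npool_ext _ h).
Qed.

Lemma guess_value_ext g g' :
  (forall i, 0 < i < 7 -> g i = g' i) -> guess_value g = guess_value g'.
Proof.
by move=> h; apply: eq_bigr => v _; rewrite (nselected_ext _ h).
Qed.

Definition input_ok (s : state R) : Prop :=
  [/\ wreg s 0 = n, forall a, a < n * n -> wmem s a = m0 a
    & forall a, a < n -> rmem s a = wt a].

Definition degrees_ok (s : state R) (i : nat) : Prop :=
  forall v, v < i -> wmem s (n * n + v) = ndeg v.

Lemma addr_lt i j : i < n -> j < n -> i * n + j < n * n.
Proof.
move=> hi hj; apply: (@leq_trans (i.+1 * n)); last by rewrite leq_mul2r hi orbT.
by rewrite mulSn addnC ltn_add2r.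
Qed.

Lemma beval_and s a b x y : beval W s a = Some x -> beval W s b = Some y ->
  @beval R W s (BAnd a b) = Some (x && y).
Proof. by move=> /= -> ->. Qed.

Lemma beval_not s a x : beval W s a = Some x ->
  @beval R W s (BNot a) = Some (~~ x).
Proof. by move=> /= ->. Qed.

Lemma beval_or s a b x y : beval W s a = Some x -> beval W s b = Some y ->
  @beval R W s (BOr a b) = Some (x || y).
Proof. by move=> /= -> -> /=; rewrite negb_and !negbK. Qed.

Lemma beval_eq s a b :
  @beval R W s (EqReg a b) = Some (wreg s a == wreg s b).
Proof. by rewrite /= eqn_leq. Qed.

Lemma beval_adj s a b : input_ok s -> wreg s a < n -> wreg s b < n ->
  beval W s (Adj co a b) = Some (nadj (wreg s a) (wreg s b)).
Proof.
move=> [s0 sm _] ha hb.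
have e : beval W s (Entry a b) = Some (entry (wreg s a) (wreg s b)).
  have h := addr_lt ha hb.
  rewrite /= s0 (wordE (x := 1)); last by lia.
  rewrite (wordE (x := _ * n)) /=; last by lia.
  by rewrite wordE /= ?sm //; lia.
rewrite /Adj /nadj; case: (co) => //.
by apply: beval_and; apply: beval_not => //; exact: beval_eq.
Qed.

Lemma weval_DegAddr s a : wreg s 0 = n -> wreg s a < n ->
  @weval R W s (DegAddr a) = Some (n * n + wreg s a).
Proof. by move=> s0 h; rewrite /= s0 wordE /= ?wordE //; lia. Qed.

Lemma beval_pool s v : input_ok s -> degrees_ok s n ->
  (forall i, 0 < i < 7 -> wreg s i < n) -> wreg s v < n ->
  beval W s (Pool co v) = Some (npool (wreg s) (wreg s v)).
Proof.
move=> si sd sg hv; have s0 : wreg s 0 = n by case: si.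
rewrite /Pool /npool.
have nadjE a b : wreg s a < n -> wreg s b < n ->
    beval W s (BNot (Adj co a b)) = Some (~~ nadj (wreg s a) (wreg s b)).
  by move=> ha hb; apply/beval_not/beval_adj.
have neqE a b : beval W s (BNot (EqReg a b)) = Some (wreg s a != wreg s b).
  exact/beval_not/beval_eq.
apply: beval_and; first by apply: nadjE => //; exact: sg.
apply: beval_and; first by apply: nadjE => //; exact: sg.
apply: beval_and; first by apply: nadjE => //; exact: sg.
do 3!(apply: beval_or; first exact: beval_eq).
apply: beval_or.
  apply: beval_and; first exact: neqE.
  by apply: beval_and; [exact: neqE|apply: nadjE => //; exact: sg].
have /= dE := weval_DegAddr s0 hv.
by rewrite ltnNge dE /= sd.
Qed.

Lemma beval_beats s u v : input_ok s -> wreg s u < n -> wreg s v < n ->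
  beval W s (Beats u v) = Some (nbeats (wreg s u) (wreg s v)).
Proof. by move=> [_ _ sr] hu hv; rewrite /= !sr. Qed.

(** [k] is the first word register that the code may overwrite; real registers are exempt. *)
Definition frame (k : nat) (s s' : state R) : Prop :=
  [/\ forall i, i < k -> wreg s' i = wreg s i, wmem s' = wmem s
    & rmem s' = rmem s].

Lemma frame_ok k s s' : 0 < k -> frame k s s' -> input_ok s -> input_ok s'.
Proof.
by move=> k0 [h1 h2 h3] [s0 sm sr]; split; rewrite ?h1 ?h2 ?h3.
Qed.

Lemma frame_degrees k s s' i : frame k s s' -> degrees_ok s i -> degrees_ok s' i.
Proof. by move=> [h1 h2 h3] sd v; rewrite h2; exact: sd. Qed.

Lemma frame_set k s s' r x : k <= r -> frame k s s' -> frame k s (set_wreg s' r x).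
Proof.
move=> kr [h1 h2 h3]; split=> // i ik /=.
by rewrite (_ : (i == r) = false) ?h1 //; apply/eqP; lia.
Qed.

Lemma run_degrees s : input_ok s ->
  run W n (Degrees co) s (fun s' =>
    [/\ input_ok s', degrees_ok s' n & rreg s' = rreg s]).
Proof.
move=> si.
apply: run_impl (run_for nW (I := fun i s' =>
  [/\ input_ok s', degrees_ok s' i & rreg s' = rreg s]) _ _ _ _) => //.
- by move=> s' [].
- by case: si.
move=> i {si}s1 ltin s10 s1i [si sd sr].
apply: (run_seq (Q1 := fun s' => [/\ input_ok s', degrees_ok s' i,
   rreg s' = rreg s, wreg s' 7 = i & wmem s' (n * n + i) = 0])).
  apply: (run_wmem n (i := n * n + i) (x := 0)).
  - by rewrite weval_DegAddr ?s1i.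
  - by rewrite /= wordE.
  split=> //=; last by rewrite eqxx.
    case: si => h0 hm hr; split=> //= a ha.
    by rewrite (_ : (a == _) = false) ?hm //; apply/eqP; lia.
  move=> v vi /=; rewrite (_ : (_ == _) = false) ?sd //.
  by apply/eqP; lia.
move=> s2 [s2i s2d s2r s27 s2m].
apply: run_impl (run_for nW (I := fun j s' =>
  [/\ input_ok s', degrees_ok s' i, rreg s' = rreg s, wreg s' 7 = i
    & wmem s' (n * n + i) = \sum_(0 <= u < j) nadj i u]) _ _ _ _) => //.
- move=> s' [s'0 [h1 h2 h3 h4 h5]]; split=> //; split=> //.
  move=> v /=; rewrite ltnS leq_eqVlt => /predU1P[-> //|]; exact: h2.
- by case: s2i.
- by split=> //; rewrite big_geq.
move=> j s3 ltjn s30 s3j [h1 h2 h3 h4 h5].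
apply: (run_if (v := nadj i j)).
  by rewrite -h4 -[in RHS]s3j beval_adj ?h4 ?s3j.
have ok : input_ok (set_wreg s3 8 j.+1) by case: h1.
have [aij|naij] := ifP; last first.
  apply: run_skip; split=> //; split=> //=.
  by rewrite h5 big_nat_recr //= naij addn0.
(* The partial count is at most [j], which is below n, so the increment stays within the word
   bound. *)
have le1 : wmem s3 (n * n + i) < n.
  rewrite h5 (leq_ltn_trans _ ltjn) //.
  rewrite -[leqRHS]muln1 -[j in leqRHS]subn0 -sum_nat_const_nat; apply: leq_sum => u _.
  exact: leq_b1.
apply: (run_wmem n (i := n * n + i) (x := (wmem s3 (n * n + i)).+1)).
- by rewrite weval_DegAddr ?h4.
- have : weval W s3 (DegAddr 7) = Some (n * n + i) by rewrite weval_DegAddr ?h4.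
  by move=> /= ->; rewrite wordE /= ?wordE ?addn1 //; lia.
split=> //; split=> //=.
- case: h1 => g0 gm gr; split=> //= a ha.
  by rewrite (_ : (a == _) = false) ?gm //; apply/eqP; lia.
- move=> v vi /=; rewrite (_ : (_ == _) = false) ?h2 //.
  by apply/eqP; lia.
- by rewrite eqxx h5 big_nat_recr //= aij addn1.
Qed.

Lemma run_AddIfSelected s : input_ok s -> degrees_ok s n ->
  (forall i, 0 < i < 8 -> wreg s i < n) ->
  run W n (AddIfSelected co) s (fun s' =>
    [/\ frame 8 s s', rreg s' 0 = rreg s 0 & rreg s' 1 =
       (rreg s 1 + if nselected (wreg s) (wreg s 7) then wt (wreg s 7) else 0)%R]).
Proof.
move=> si sd sg.
have sg' i : 0 < i < 7 -> wreg s i < n.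
  by case/andP=> i0 i7; apply: sg; rewrite i0 ltnW.
have fr s' i : frame 8 s s' -> i < 8 -> wreg s' i = wreg s i.
  by case=> h _ _; exact: h.
(* Registers 1 to 6 still hold the guess, so pool tests inside the loop refer to the initial
   state. *)
have okp s' v : frame 8 s s' -> wreg s' v < n ->
    beval W s' (Pool co v) = Some (npool (wreg s) (wreg s' v)).
  move=> f hv; rewrite beval_pool //; first 1 last.
  - exact: frame_ok f si.
  - exact: frame_degrees f sd.
  - by move=> i hi; rewrite (fr _ _ f) ?sg' //; lia.
  by rewrite (npool_ext (g' := wreg s)) // => i hi; rewrite (fr _ _ f) //; lia.
have fs : frame 8 s s by [].
apply: run_if; first by apply: okp => //; exact: sg.
rewrite /nselected; have [_|_] := ifP; last by apply: run_skip; rewrite addr0.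
rewrite [(true && _)]/=.
apply: (run_seq (Q1 := fun s' => [/\ frame 8 s s', rreg s' = rreg s
    & wreg s' 9 = true])).
  apply: (run_wreg n (x := 1)); first by rewrite /= wordE //; lia.
  by split=> //; exact: frame_set.
pose bad u := [&& npool (wreg s) u, nadj (wreg s 7) u & nbeats u (wreg s 7)].
move=> s1 [f1 r1 ok1].
apply: (run_seq (Q1 := fun s' => [/\ frame 8 s s', rreg s' = rreg s
    & wreg s' 9 = all (fun u => ~~ bad u) (iota 0 n)])).
  apply: run_impl (run_for nW (I := fun j s' => [/\ frame 8 s s', rreg s' = rreg s
    & wreg s' 9 = all (fun u => ~~ bad u) (iota 0 j)]) _ _ _ _) => //.
  - by move=> s' [].
  - by rewrite (fr _ _ f1) //; case: si.
  - by split=> //; exact: frame_set.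
  move=> j s2 ltjn s20 s2j [f2 r2 ok2].
  have s27 := fr s2 7 f2 isT.
  have okI := frame_ok (k := 8) isT f2 si.
  apply: run_if.
    apply: beval_and; first by apply: okp; rewrite ?s2j.
    apply: beval_and; first by apply: beval_adj; rewrite ?s27 ?s2j // sg.
    by apply: beval_beats; rewrite ?s27 ?s2j // sg.
  rewrite s2j s27 -/(bad j).
  have step : all (fun u => ~~ bad u) (iota 0 j.+1) =
      all (fun u => ~~ bad u) (iota 0 j) && ~~ bad j.
    by rewrite -addn1 iotaD all_cat /= add0n andbT.
  have [bj|nbj] := ifP.
    apply: (run_wreg n (x := 0)); first by rewrite /= wordE.
    split=> //; split=> //; first by do 2!apply: frame_set => //.
    by rewrite step bj andbF.
  apply: run_skip; split=> //; split=> //; first exact: frame_set.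
  by rewrite step nbj andbT.
move=> s2 [f2 r2 ok2].
have okI := frame_ok (k := 8) isT f2 si.
apply: (run_if (v := all (fun u => ~~ bad u) (iota 0 n))).
  by rewrite /= wordE ?ok2 /=; [case: all|lia].
have [_|_] := ifP; last by apply: run_skip; rewrite r2 addr0.
have s27 := fr s2 7 f2 isT.
apply: run_rreg; first by rewrite /=.
split=> //=; first by rewrite r2.
by rewrite r2 s27; case: okI => _ _ ->; rewrite ?sg.
Qed.

Lemma run_TryGuess s : input_ok s -> degrees_ok s n ->
  (forall i, 0 < i < 7 -> wreg s i < n) ->
  run W n (TryGuess co) s (fun s' =>
    frame 7 s s' /\ rreg s' 0 = Num.max (rreg s 0) (guess_value (wreg s))).
Proof.
move=> si sd sg.
apply: (run_seq (Q1 := fun s' =>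
    [/\ frame 7 s s', rreg s' 0 = rreg s 0 & rreg s' 1 = 0%R])).
  exact: run_rreg.
move=> s1 [f1 r10 r11].
apply: (run_seq (Q1 := fun s' =>
    [/\ frame 7 s s', rreg s' 0 = rreg s 0 & rreg s' 1 = guess_value (wreg s)])).
  apply: run_impl (run_for nW (I := fun i s' =>
    [/\ frame 7 s s', rreg s' 0 = rreg s 0 & rreg s' 1 =
      (\sum_(0 <= v < i) if nselected (wreg s) v then wt v else 0)%R]) _ _ _ _) => //.
  - by move=> s' [].
  - by case: f1 => -> // _ _; case: si.
  - by split=> //=; [exact: frame_set|rewrite big_geq].
  move=> i s2 ltin s20 s27 [f2 r20 r21].
  have wE j : 0 < j < 7 -> wreg s2 j = wreg s j.
    by case: f2 => h _ _ /andP[_ j7]; exact: h.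
  apply: run_impl (run_AddIfSelected (frame_ok (k := 7) isT f2 si)
    (frame_degrees f2 sd) _).
    move=> s' [f r0 r1]; case: (f) => fw fm fr.
    have f7 : frame 7 s s'.
      by case: f2 => gw gm gr; split; rewrite ?fm ?fr // => j hj;
         rewrite fw ?gw //; lia.
    split; rewrite ?fw //; split; first exact: frame_set.
      by rewrite /= r0.
    rewrite /= r1 r21 big_nat_recr //= s27.
    by rewrite (nselected_ext _ wE).
  move=> j /andP[j0]; rewrite ltnS leq_eqVlt => /predU1P[->|j7].
    by rewrite s27.
  by rewrite wE ?sg ?j0.
move=> s2 [f2 r20 r21].
apply: run_if; first by rewrite /=.
rewrite r20 r21; case: leP => [le|lt]; first by apply: run_skip; rewrite r20.
by apply: run_rreg => //; split=> //=; rewrite r21.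
Qed.

(** To be instantiated by being the weight of an independent set; as an invariant it keeps the
    output from being too large. *)
Variable achieved : R -> Prop.
Hypothesis guess_achieved : forall g,
  (forall i, 0 < i < 7 -> g i < n) -> achieved (guess_value g).

(** Induction on the number of loops still to open: the enclosing loops fix the registers below [d],
    so the maximum is over the guesses that extend them. *)
Lemma run_Nest k d s : 0 < d -> d + k = 7 ->
  input_ok s -> degrees_ok s n -> achieved (rreg s 0) ->
  (forall i, 0 < i < d -> wreg s i < n) ->
  run W n (Nest d k (TryGuess co)) s (fun s' =>
    [/\ frame d s s', achieved (rreg s' 0), (rreg s 0 <= rreg s' 0)%R
      & forall g, (forall i, 0 < i < d -> g i = wreg s i) ->
          (forall i, 0 < i < 7 -> g i < n) -> (guess_value g <= rreg s' 0)%R]).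
Proof.
elim: k d s => [|k IH] d s d0.
  rewrite addn0 => -> si sd sa sg; apply: run_impl (run_TryGuess si sd sg).
  move=> s' [f ->]; split=> //.
  - by case: leP => // _; exact: guess_achieved.
  - by rewrite le_max lexx.
  - by move=> g hg _; rewrite (guess_value_ext hg) le_max lexx orbT.
rewrite -addSnnS => dk si sd sa sg.
apply: run_impl (run_for nW (I := fun j s' =>
    [/\ frame d s s', achieved (rreg s' 0), (rreg s 0 <= rreg s' 0)%R
      & forall g, (forall i, 0 < i < d -> g i = wreg s i) -> g d < j ->
          (forall i, 0 < i < 7 -> g i < n) -> (guess_value g <= rreg s' 0)%R])
   _ _ _ _) => //.
- move=> s' [_ [f a le h]]; split=> // g hg gn; apply: h => //.
  by apply: gn; lia.
- by rewrite -lt0n.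
- by case: si.
- by split=> //; exact: frame_set.
move=> j s1 ltjn s10 s1d [f1 a1 le1 h1].
have wE i : i < d -> wreg s1 i = wreg s i by case: f1 => h _ _; exact: h.
apply: run_impl (IH d.+1 s1 _ dk (frame_ok d0 f1 si) (frame_degrees f1 sd) a1 _) => //.
  move=> s2 [f2 a2 le2 h2]; have [w2 m2 r2] := f2.
  split; rewrite ?w2 //; split=> //.
  - apply: frame_set => //; case: f1 => w1 m1 r1.
    by split; rewrite ?m2 ?r2 // => i id; rewrite w2 ?w1 //; lia.
  - exact: le_trans le1 le2.
  (* Guesses with [g d = j] are covered by the inner loops, those with smaller [g d] by earlier
     iterations. *)
  move=> g hg; rewrite ltnS leq_eqVlt => /predU1P[gd|gd] gn.
    apply: h2 => // i /andP[i0]; rewrite ltnS leq_eqVlt => /predU1P[->|id].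
      by rewrite gd.
    by rewrite wE // hg ?i0.
  by apply: le_trans le2; exact: h1.
move=> i /andP[i0]; rewrite ltnS leq_eqVlt => /predU1P[->|id]; first by rewrite s1d.
by rewrite wE // sg // i0.
Qed.

Lemma run_MaxIndependent s : input_ok s -> achieved (rreg s 0) ->
  run W n (MaxIndependent co) s (fun s' => achieved (rreg s' 0) /\
    forall g, (forall i, 0 < i < 7 -> g i < n) -> (guess_value g <= rreg s' 0)%R).
Proof.
move=> si sa; apply: run_seq (run_degrees si) _ => s1 [s1i s1d r1].
apply: run_impl (run_Nest (k := 6) (d := 1) _ _ s1i s1d _ _) => //.
- by move=> s' [f a _ h]; split=> // g gn; apply: h => // -[|i].
- by rewrite r1.
- by move=> i; case: i.
Qed.

End Correctness.

(** * From vertex numbers to vertices *)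

Section Labelling.
Variables (R : realType) (G : sgraph) (w : G -> R) (n : nat) (lab : 'I_n -> G).
Variables (rk : G -> 'I_n) (co : bool) (m0 : nat -> nat) (wt : nat -> R).
Hypotheses (labK : cancel lab rk) (rkK : cancel rk lab).
Hypothesis nadj_lab : forall i j : 'I_n, nadj n co m0 i j = adj (lab i) (lab j).
Hypothesis wt_lab : forall i : 'I_n, wt i = w (lab i).

Lemma ndeg_lab (i : 'I_n) : ndeg n co m0 i = deg (lab i).
Proof.
rewrite /ndeg /deg /deg_in big_mkord -sum1_card (reindex lab) /=; last first.
  by apply: onW_bij; exists rk.
rewrite [RHS]big_mkcond; apply: eq_bigr => j _.
by rewrite nadj_lab !inE; case: adj.
Qed.

Lemma npool_lab (g : nat -> nat) (x y f1 f2 f3 i : 'I_n) :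
  [/\ g 1 = x, g 2 = y, g 4 = f1, g 5 = f2 & g 6 = f3] ->
  npool n co m0 g i =
    (lab i \in pool (lab x) (lab y) (g 3) (lab f1) (lab f2) (lab f3)).
Proof.
rewrite /npool => -[-> -> -> -> ->]; rewrite inE -!nadj_lab -ndeg_lab.
by rewrite !(can_eq labK).
Qed.

(** Reindexing along [lab]. The threshold [g 3] is a number and is not translated; ranks are vertex
    numbers, so ties break as in the program. *)
Lemma guess_value_lab (g : nat -> nat) (x y f1 f2 f3 : 'I_n) :
  [/\ g 1 = x, g 2 = y, g 4 = f1, g 5 = f2 & g 6 = f3] ->
  guess_value n co m0 wt g =
    (\sum_(v in selection w (fun v => rk v)
      (pool (lab x) (lab y) (g 3) (lab f1) (lab f2) (lab f3))) w v)%R.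
Proof.
move=> hg; rewrite /guess_value big_mkord -big_mkcond (reindex lab) /=; last first.
  by apply: onW_bij; exists rk.
have nbE (i j : 'I_n) :
    nbeats wt i j = beats w (fun v => rk v) (lab i) (lab j).
  by rewrite /nbeats /beats !wt_lab !labK.
apply: eq_big => i; last by rewrite wt_lab.
rewrite !inE /nselected (npool_lab i hg) inE; congr (_ && _).
apply/allP/forall_inP => [h u uP|h u].
  have := h (rk u); rewrite mem_iota ltn_ord (npool_lab _ hg) rkK uP nadj_lab nbE.
  by rewrite rkK; exact.
rewrite mem_iota => /andP[_ un].
have /= := npool_lab (Ordinal un) hg; move=> ->.
case: (boolP (_ \in _)) => //= uP.
by have := h _ uP; rewrite -nadj_lab -nbE.
Qed.

End Labelling.

Lemma run_weighted_independence (R : realType) (G : sgraph) (w : G -> R)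
    (n : nat) (lab : 'I_n -> G) (co : bool) (W : nat) (s : state R) :
  maya_tupi G -> (forall v, 0 < w v)%R -> bijective lab -> n * n + n.+1 < W ->
  wreg s 0 = n -> rreg s 0 = 0%R ->
  (forall i j : 'I_n, nadj n co (wmem s) i j = adj (lab i) (lab j)) ->
  (forall i : 'I_n, rmem s i = w (lab i)) ->
  run W n (MaxIndependent co) s
    (fun s' => rreg s' 0 = weighted_independence_number w).
Proof.
move=> mt w0 labB nW s0 sr hadj hw; case: (labB) => rk labK rkK.
have cardG : #|G| = n by rewrite -(bij_eq_card labB) card_ord.
have rk_inj : injective (fun v => rk v : nat).
  by move=> u v /val_inj/(can_inj rkK).
pose achieved x := exists2 S : {set G}, independent S & (x = \sum_(v in S) w v)%R.
have guessE := guess_value_lab labK rkK hadj hw.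
apply: run_impl (run_MaxIndependent (co := co) (m0 := wmem s) (wt := rmem s)
  nW (achieved := achieved) _ _ _).
- move=> s' [ach h]; apply: weighted_independence_numberP => // S iS.
  (* The empty set has no good guess to rely on; its weight 0 is below any achieved value. *)
  have [->|S0] := eqVneq S set0.
    rewrite big_set0; case: ach => T _ ->.
    by apply: sumr_ge0 => v _; exact: ltW.
  have [x [y [t [f1 [f2 [f3 [tn le]]]]]]] :=
    pool_complete (fun v => rk v : nat) w0 mt S0 iS.
  (* Position 0 is a placeholder, since register 0 holds n and is not guessed. *)
  pose g i := nth 0 [:: 0; rk x : nat; rk y : nat; t; rk f1 : nat; rk f2 : nat;
                     rk f3 : nat] i.
  apply: (le_trans _ (h g _)); last first.
    by rewrite cardG in tn; do 7?[case=> //]; rewrite /g /=.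
  by rewrite (guessE g (rk x) (rk y) (rk f1) (rk f2) (rk f3)) ?rkK.
- move=> g hg; have l i : 0 < i < 7 -> {j : 'I_n | g i = j}.
    by move=> /hg gi; exists (Ordinal gi).
  have [[x hx] [y hy]] := (l 1 isT, l 2 isT).
  have [[f1 h1] [f2 h2] ] := (l 4 isT, l 5 isT); have [f3 h3] := l 6 isT.
  eexists; last exact: (guessE g x y f1 f2 f3).
  exact: selection_independent.
- by [].
(* The initial output 0 is the weight of the empty set. *)
- by rewrite sr; exists set0; [apply/forall_inP => u; rewrite inE|rewrite big_set0].
Qed.

(** * The encoding of the input *)

Section Input.
Variables (R : realType) (G : sgraph) (w : G -> R) (n : nat) (lab : 'I_n -> G).

Lemma entry_input (i j : 'I_n) :
  entry n (wmem (input_state w lab)) i j = adj (lab i) (lab j).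
Proof.
have n0 : 0 < n := leq_ltn_trans (leq0n i) (ltn_ord i).
rewrite /entry /= divnMDl // divn_small // addn0 modnMDl modn_small // !valK.
exact: lt0b.
Qed.

Lemma rmem_input (i : 'I_n) : rmem (input_state w lab) i = w (lab i).
Proof. by rewrite /= valK. Qed.

End Input.

Theorem corollary6p2 (R : realType) :
  @computable_in_time R maya_tupi
    (fun G w => weighted_independence_number w) (fun n => n ^ 8)
  /\
  @computable_in_time R maya_tupi
    (fun G w => weighted_clique_number w) (fun n => n ^ 8).
Proof.
split.
  (* Two suffices because (n + 2)^2 exceeds n^2 + n + 1. *)
  exists (MaxIndependent false), 2, (cost (MaxIndependent false)).
  move=> G w n lab mt w0 labB.
  apply: (run_weighted_independence mt w0 labB) => //; first by nia.
    exact: entry_input.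
  exact: rmem_input.
exists (MaxIndependent true), 2, (cost (MaxIndependent true)).
move=> G w n lab mt w0 labB; rewrite weighted_clique_cograph.
(* The program with [co] set reads the matrix of [G] but works on its complement. *)
apply: (@run_weighted_independence R (cograph G) w n lab true) => //.
- exact: cograph_maya_tupi.
- by nia.
- move=> i j; rewrite /nadj entry_input /= /coadj.
  by rewrite (inj_eq (bij_inj labB)).
- exact: rmem_input.
Qed.
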